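(* Let $f:S^1\to S^1$ be a homeomorphism of the unit circle. Then $f$ is pairwise sensitive with respect to some Borel probability measure $\mu$ on $S^1$ if and only if $f$ is Denjoy.
   Context: Pairwise sensitivity: a homeomorphism $f:X\to X$ of a compact metric space $(X,d)$ is pairwise sensitive with respect to a Borel probability measure $\mu$ on $X$ if there is $\delta>0$ such that for $\mu\otimes\mu$-a.e. $(x,y)\in X\times X$ (where $\mu\otimes\mu$ is the product measure) there is $n\in\mathbb{Z}$ with $d(f^n(x),f^n(y))\geq\delta$. Here $S^1$ denotes the unit circle. Denjoy: an orientation-preserving homeomorphism of the circle $S^1$ is called Denjoy if it is not topologically conjugate to a rotation.
   Formalization: ''Denjoy'' is taken to mean orientation preserving, without periodic points, and not topologically conjugate to a rotation; without ''no periodic points'' the claim fails, e.g. for a map with one attracting and one repelling fixed point. *)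

(* Defs.v *)
From HB Require Import structures.
From mathcomp Require Import all_boot all_order all_algebra.
From mathcomp Require Import all_classical all_reals all_analysis.
From mathcomp Require Import complex.

Set Implicit Arguments.
Unset Strict Implicit.
Unset Printing Implicit Defensive.

Import Order.TTheory GRing.Theory Num.Theory.
Import numFieldNormedType.Exports.
Import ComplexField.Normc.

Local Open Scope classical_set_scope.
Local Open Scope ring_scope.

(* The library's [g_sigma_algebraType] requires a pointed carrier; a space
   carrying a probability measure is nonempty anyway. *)
#[short(type="pmetricType")]
HB.structure Definition PMetric (K : numDomainType) :=
  {M of Metric K M & isPointed M}.

Record homeo (X : topologicalType) := Homeo {
  homeo_fun :> X -> X;
  homeo_inv : X -> X;
  homeo_funK : cancel homeo_fun homeo_inv;
  homeo_invK : cancel homeo_inv homeo_fun;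
  homeo_cont : continuous homeo_fun;
  homeo_inv_cont : continuous homeo_inv
}.

(* [Negz n] is the integer -(n+1). *)
Definition homeo_iter (X : topologicalType) (f : homeo X) (n : int) : X -> X :=
  match n with
  | Posz n => iter n f
  | Negz n => iter n.+1 (homeo_inv f)
  end.

Definition conjugate (X : topologicalType) (f g : X -> X) : Prop :=
  exists h : homeo X, forall x, h (f x) = g (h x).

Definition borel (X : ptopologicalType) := g_sigma_algebraType (@open X).

Section pairwise_sensitivity.
Context {R : realType} {X : pmetricType R}.

Definition pairwise_sensitive (f : homeo X) (mu : probability (borel X) R)
  : Prop :=
  exists2 delta : R, 0 < delta &
    {ae (mu \x mu)%E, forall p : borel X * borel X,
      exists n : int,
        delta <= mdist (homeo_iter f n p.1 : X) (homeo_iter f n p.2 : X)}.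

End pairwise_sensitivity.

Section circle.
Variable R : realType.

(* [normc] is the R-valued modulus; the generic norm of [R[i]] takes its
   values in [R[i]]. *)
Definition circle := {z : R[i] | normc z == 1}.

HB.instance Definition _ := Choice.on circle.

Definition circle_dist (z w : circle) : R := normc (val z - val w).

Let circle_distxx z : circle_dist z z = 0.
Proof. by rewrite /circle_dist subrr normc0. Qed.

Let circle_dist_positivity z w : circle_dist z w = 0 -> z = w.
Proof. by move=> /eq0_normc /eqP; rewrite subr_eq0 => /eqP /val_inj. Qed.

Let circle_dist_sym z w : circle_dist z w = circle_dist w z.
Proof. by rewrite /circle_dist -normcN opprB. Qed.

Let circle_dist_triangle w z v :
  circle_dist z v <= circle_dist z w + circle_dist w v.
Proof.
by rewrite /circle_dist (le_trans _ (le_normcD _ _)) // addrA subrK.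
Qed.

HB.instance Definition _ := @isMetric.Build R circle circle_dist
  circle_distxx circle_dist_positivity circle_dist_sym circle_dist_triangle.

Fact normc_cis (t : R) : normc (Complex (cos t) (sin t)) == 1.
Proof. by rewrite /normc cos2Dsin2 sqrtr1. Qed.

Definition cis (t : R) : circle := Sub (Complex (cos t) (sin t)) (normc_cis t).

HB.instance Definition _ := isPointed.Build circle (cis 0).

Fact normc_circleM (a z : circle) : normc (val a * val z) == 1.
Proof. by rewrite normcM (eqP (valP a)) (eqP (valP z)) mulr1. Qed.

Definition rotation (a z : circle) : circle :=
  Sub (val a * val z) (normc_circleM a z).

(* A homeomorphism preserves orientation when it has an increasing lift to the
   universal cover [cis]. *)
Definition orientation_preserving (f : homeo circle) : Prop :=
  exists F : R -> R,
    [/\ continuous F, {homo F : s t / s < t} &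
        forall t, f (cis t) = cis (F t)].

Definition periodic_point (f : homeo circle) (z : circle) : Prop :=
  exists n : nat, iter n.+1 f z = z.

(* A Denjoy homeomorphism has irrational rotation number, that is, no periodic
   point.  The one-line description "orientation preserving and not conjugate
   to a rotation" leaves this implicit; without it the description would also
   cover every map with periodic points that is not of finite order, such as
   one with an attracting and a repelling fixed point, and no such map is
   pairwise sensitive. *)
Definition denjoy (f : homeo circle) : Prop :=
  [/\ orientation_preserving f,
      (forall z, ~ periodic_point f z) &
      ~ exists a : circle, conjugate f (rotation a)].

End circle.

(* Main.v *)
(** A periodic point excludes pairwise sensitivity: some power of [f] then has
    an increasing lift with a fixed point, close fixed points stay close
    forever, and any other point is stable because its fundamental domain has
    pairwise disjoint iterates.  A second countable space is thus covered, up
    to null sets, by sets too small to be separated.  Conjugates of rotations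
    are equicontinuous, hence excluded as well, and an orientation reversing
    homeomorphism has a fixed point.

    Conversely, let [H] be the lift of a Denjoy map and [alpha] its translation
    number.  Sending [n alpha + 2 pi m] to [H^n 0 + 2 pi m] preserves the order
    and extends to a strictly increasing [g] with [g (t + alpha) = H (g t)].  If
    [g] were continuous it would conjugate [f] to a rotation, so [g] jumps
    somewhere; a suitable iterate moves any two distinct points [g s], [g t]
    to opposite sides of this jump, which keeps them a fixed distance apart.
    The measure is the law of [cis (g U)] with [U] uniform, for which [U] and
    an independent copy almost surely differ modulo [2 pi]. *)

Require Import Defs.
From mathcomp Require Import all_boot all_order all_algebra.
From mathcomp Require Import all_classical all_reals all_analysis.
From mathcomp Require Import measurable_realfun complex zify ring lra.

Set Implicit Arguments.
Unset Strict Implicit.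
Unset Printing Implicit Defensive.

Import Order.TTheory GRing.Theory Num.Theory.
Import numFieldNormedType.Exports.
Import ComplexField.Normc.

Local Open Scope classical_set_scope.
Local Open Scope ring_scope.

(** * Integer iterates and powers of a homeomorphism *)

Section homeomorphisms.
Context {X : topologicalType}.
Implicit Types f g : homeo X.

Lemma homeo_inj f : injective f.
Proof. exact: can_inj (homeo_funK f). Qed.

Lemma homeo_iter_succ f (n : int) x :
  homeo_iter f (n + 1) x = f (homeo_iter f n x).
Proof.
case: n => [n|[|n]].
- by rewrite -PoszD addn1.
- by rewrite /= homeo_invK.
- have -> : Negz n.+1 + 1 = Negz n by rewrite !NegzE; lia.
  by rewrite /= homeo_invK.
Qed.

Lemma homeo_iterD f (n m : int) x :
  homeo_iter f (n + m) x = homeo_iter f n (homeo_iter f m x).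
Proof.
elim/int_ind: n => [|n IH|n IH]; first by rewrite add0r.
  by rewrite -addn1 PoszD addrAC !homeo_iter_succ IH.
have e k : - n%:Z + k = - n.+1%:Z + k + 1 by lia.
apply: (@homeo_inj f).
by rewrite -homeo_iter_succ -e IH -homeo_iter_succ -[- _ + 1]addr0 addrAC -e addr0.
Qed.

Lemma homeo_iterN f (n : int) x : homeo_iter f n (homeo_iter f (- n) x) = x.
Proof. by rewrite -homeo_iterD subrr. Qed.

Lemma homeo_iterNK f (n : int) : cancel (homeo_iter f n) (homeo_iter f (- n)).
Proof. by move=> x; rewrite -homeo_iterD addNr. Qed.

(** The right-hand side is the unfolded [n]-th iterate of [homeo_pow f m], written out because that
    homeomorphism is only built below. *)
Lemma homeo_iterM f (n m : int) x :
  homeo_iter f (n * m) x =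
  match n with
  | Posz n => iter n (homeo_iter f m) x
  | Negz n => iter n.+1 (homeo_iter f (- m)) x
  end.
Proof.
have pos (k : nat) (p : int) : homeo_iter f (k%:Z * p) x = iter k (homeo_iter f p) x.
  elim: k => [|k IH]; first by rewrite mul0r.
  by rewrite -addn1 PoszD mulrDl mul1r addrC homeo_iterD IH addn1.
case: n => n; first exact: pos.
by rewrite NegzE mulNr -mulrN pos.
Qed.

Lemma homeo_iter_cont f (n : int) : continuous (homeo_iter f n).
Proof.
have it (g : X -> X) k : continuous g -> continuous (iter k g).
  move=> cg; elim: k => [|k IH] x; first exact: cvg_id.
  by apply: continuous_comp; [exact: IH|exact: cg].
case: n => n; apply: it; [exact: homeo_cont|exact: homeo_inv_cont].
Qed.

Definition homeo_pow f (n : int) : homeo X :=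
  Homeo (@homeo_iterNK f n) (homeo_iterN f n)
    (@homeo_iter_cont f n) (@homeo_iter_cont f (- n)).

Lemma homeo_iter_pow f (n m : int) x :
  homeo_iter (homeo_pow f n) m x = homeo_iter f (m * n) x.
Proof. by rewrite homeo_iterM; case: m. Qed.

End homeomorphisms.

(** * The circle and its universal cover *)

Section circle_geometry.
Variable R : realType.
Local Notation T := (2 * pi : R).
Local Notation circle := (circle R).
Implicit Types (s t : R) (z w : circle).

Definition xc z : R := complex.Re (val z).
Definition yc z : R := complex.Im (val z).

Lemma circle_eqP z w : xc z = xc w -> yc z = yc w -> z = w.
Proof.
rewrite /xc /yc => h1 h2; apply: val_inj.
by case: (val z) (val w) h1 h2 => [a b] [c d] /= -> ->.
Qed.

Lemma circle_sqr z : xc z ^+ 2 + yc z ^+ 2 = 1.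
Proof.
case: z => [[a b] /= h]; rewrite /xc /yc /=; move/eqP: h; rewrite /normc => h.
by rewrite -(@sqr_sqrtr _ (a ^+ 2 + b ^+ 2)) ?addr_ge0 ?sqr_ge0// h expr1n.
Qed.

Lemma circle_mdist z w : mdist z w =
  Num.sqrt ((xc z - xc w) ^+ 2 + (yc z - yc w) ^+ 2).
Proof. by case: z w => [[a b] ?] [[c d] ?]. Qed.

Lemma circle_mdist_sqr z w : mdist z w ^+ 2 = 2 - 2 * (xc z * xc w + yc z * yc w).
Proof.
rewrite circle_mdist sqr_sqrtr ?addr_ge0 ?sqr_ge0//.
have := circle_sqr z; have := circle_sqr w; nra.
Qed.

Lemma xc_cis t : xc (cis t) = cos t. Proof. by []. Qed.
Lemma yc_cis t : yc (cis t) = sin t. Proof. by []. Qed.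

Lemma mdist_cis_sqr s t : mdist (cis s) (cis t) ^+ 2 = 2 - 2 * cos (s - t).
Proof. by rewrite circle_mdist_sqr cosB. Qed.

End circle_geometry.

Arguments xc {R} z.
Arguments yc {R} z.

(* Without this instance, inference unfolds [nbhs] on [circle] and fails. *)
#[global] Instance circle_nbhs_filter (R : realType) (z : circle R) :
  Filter (nbhs z).
Proof. exact: nbhs_filter. Qed.

(** * The argument function, rotations and local sections of [cis] *)

Section argument.
Variable R : realType.
Local Notation T := (2 * pi : R).
Local Notation circle := (circle R).
Implicit Types (s t : R) (z w : circle).

Lemma period_gt0 : 0 < T.
Proof. by rewrite mulr_gt0 ?pi_gt0. Qed.

Lemma cisDT t : cis (t + T) = cis t.
Proof.
have -> : T = pi *+ 2 by rewrite mulr_natl.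
by apply: circle_eqP; rewrite ?xc_cis ?yc_cis; [exact: cosD2pi|exact: sinD2pi].
Qed.

Lemma periodicz (Y : Type) (g : R -> Y) : (forall t, g (t + T) = g t) ->
  forall t (m : int), g (t + m%:~R * T) = g t.
Proof.
move=> gT t m; elim/int_ind: m t => [|n IH|n IH] t; first by rewrite mul0r addr0.
  by rewrite -[n.+1]addn1 PoszD intrD mulrDl mul1r addrA gT IH.
by rewrite -gT -[RHS]IH; congr g; rewrite -[n.+1]addn1 PoszD opprD intrD; ring.
Qed.

Lemma cisDz t (m : int) : cis (t + m%:~R * T) = cis t.
Proof. exact: (periodicz cisDT). Qed.

Lemma modT_exists t : exists m : int, 0 <= t - m%:~R * T < T.
Proof.
exists (Num.floor (t / T)); have T0 := period_gt0.
have /andP[h1 h2] := floor_itv (t / T).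
rewrite subr_ge0 -ler_pdivlMr // h1 /= ltrBlDr -[X in _ < X + _]mul1r -mulrDl.
by rewrite -ltr_pdivrMr // addrC -[X in _ + X]/(1%:~R) -intrD.
Qed.

Lemma cos_eq1 t : 0 <= t < T -> cos t = 1 -> t = 0.
Proof.
move=> /andP[t0 tT] ct; have p0 := @pi_ge0 R.
have [tp|tp] := leP t pi.
  by apply: (@cos_inj R); rewrite ?cos0 ?ct ?in_itv /= ?lexx ?p0 ?t0 ?tp.
(* Past [pi], the reflection [T - t] returns to the interval where the cosine is injective. *)
have c2 : cos (T - t) = 1.
  by have := xc_cis (- t + T); rewrite cisDT xc_cis cosN ct addrC.
suff : T - t = 0 by move=> /eqP; rewrite subr_eq0 => /eqP e; rewrite e ltxx in tT.
apply: (@cos_inj R); rewrite ?cos0 ?c2 ?in_itv /= ?lexx ?p0 //.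
by apply/andP; split; lra.
Qed.

Lemma cis_eq s t : cis s = cis t -> exists m : int, s = t + m%:~R * T.
Proof.
move=> e; have [m mP] := modT_exists (s - t).
exists m; suff : s - t - m%:~R * T = 0 by lra.
apply: cos_eq1 => //.
have -> : s - t - m%:~R * T = s - (t + m%:~R * T) by ring.
rewrite cosB -!xc_cis -!yc_cis cisDz e -!expr2; exact: circle_sqr.
Qed.

(* For [z <> cis 0], [yc z / (1 - xc z)] is the cotangent of half the argument;
   at [cis 0] this quotient is [0 / 0 = 0], whence the case distinction. *)
Definition arg z : R :=
  if z == cis 0 then 0 else pi - 2 * atan (yc z / (1 - xc z)).

Lemma xc_lt1 z : z != cis 0 -> xc z < 1.
Proof.
move=> z1; rewrite lt_neqAle; have h := circle_sqr z; apply/andP; split.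
  apply: contra z1 => /eqP x1; apply/eqP/circle_eqP; rewrite ?xc_cis ?yc_cis ?cos0 ?sin0 //.
  by move: h; rewrite x1; nra.
by nra.
Qed.

Lemma cos2_atan (q : R) : cos (atan q) ^+ 2 = (1 + q ^+ 2)^-1.
Proof.
by rewrite cos_atan exprVn sqr_sqrtr // addr_ge0 // sqr_ge0.
Qed.

Lemma sin_cos_atan (q : R) : sin (atan q) = q * cos (atan q).
Proof.
have c0 : cos (atan q) != 0.
  rewrite cos_atan invr_eq0 sqrtr_eq0 -ltNge.
  by rewrite ltr_pwDl // sqr_ge0.
by rewrite -[X in X * _]atanK /tan divfK.
Qed.

Lemma argK z : cis (arg z) = z.
Proof.
rewrite /arg; case: eqVneq => [->//|z1].
have x1 := xc_lt1 z1; have h := circle_sqr z.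
set q := yc z / (1 - xc z).
have y_ : yc z = q * (1 - xc z) by rewrite /q mulrVK // unitfE subr_eq0 gt_eqF.
(* On the circle [q ^+ 2 = (1 + xc z) / (1 - xc z)]; the double-angle formulas then recover both
   coordinates. *)
have q2 : (1 + q ^+ 2)^-1 = (1 - xc z) / 2.
  apply: (@mulfI _ (1 + q ^+ 2)); first by nra.
  rewrite mulfV; last by nra.
  by nra.
have cpi a : cos (pi - a) = - cos a :> R by rewrite cosB cospi sinpi; ring.
have spi a : sin (pi - a) = sin a :> R by rewrite sinB cospi sinpi; ring.
apply: circle_eqP; rewrite ?xc_cis ?yc_cis ?cpi ?spi mulr_natl.
  rewrite cos_mulr2n cos2_atan q2; lra.
rewrite sin_mulr2n sin_cos_atan -mulr_natl.
transitivity (2 * q * cos (atan q) ^+ 2); first by ring.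
by rewrite cos2_atan q2 y_; field.
Qed.

Lemma arg_cis0 : arg (cis 0) = 0.
Proof. by rewrite /arg eqxx. Qed.

Lemma arg_itvoo z : z != cis 0 -> 0 < arg z < T.
Proof.
move=> z1; rewrite /arg (negbTE z1).
have := atan_gtNpi2 (yc z / (1 - xc z)); have := atan_ltpi2 (yc z / (1 - xc z)).
move: (atan _) => a *; lra.
Qed.

Lemma arg_itv z : 0 <= arg z < T.
Proof.
have [->|/arg_itvoo/andP[h1 h2]] := eqVneq z (cis 0).
  by rewrite arg_cis0 lexx period_gt0.
by rewrite (ltW h1) h2.
Qed.

Lemma arg_cis t : 0 <= t < T -> arg (cis t) = t.
Proof.
move=> tP; have [m h] := cis_eq (argK (cis t)).
have := arg_itv (cis t); have T0 := period_gt0.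
move: tP => /andP[t0 tT] /andP[]; rewrite h => a0 aT.
suff -> : m = 0 by rewrite mul0r addr0.
have m1 : m%:~R * T < 1%:~R * T by rewrite mul1r; lra.
have m2 : (-1)%:~R * T < m%:~R * T by rewrite mulN1r; lra.
by move: m1 m2; rewrite !ltr_pM2r // !ltr_int; lia.
Qed.

Lemma cis_neq1 t : 0 < t < T -> cis t != cis 0.
Proof.
move=> /andP[t0 tT]; apply/eqP => /(congr1 arg).
rewrite arg_cis0 arg_cis ?(ltW t0)// => e; by rewrite e ltxx in t0.
Qed.

Lemma arg_inj : injective arg.
Proof. exact: can_inj argK. Qed.

Lemma near_mdist z (e : R) : 0 < e -> \forall w \near z, mdist z w < e.
Proof. by move=> e0; apply/nbhs_ballP; exists e => // w; rewrite ballEmdist. Qed.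

Lemma xc_cont : continuous (@xc R).
Proof.
move=> z; rewrite /continuous_at; apply/cvgrPdist_lt => e e0.
apply: filterS (near_mdist z e0) => w.
apply: le_lt_trans; rewrite -sqrtr_sqr circle_mdist ler_sqrt ?lerDl ?sqr_ge0 //.
by rewrite addr_ge0 ?sqr_ge0.
Qed.

Lemma yc_cont : continuous (@yc R).
Proof.
move=> z; rewrite /continuous_at; apply/cvgrPdist_lt => e e0.
apply: filterS (near_mdist z e0) => w.
apply: le_lt_trans; rewrite -sqrtr_sqr circle_mdist ler_sqrt ?lerDr ?sqr_ge0 //.
by rewrite addr_ge0 ?sqr_ge0.
Qed.

(** The squared distance is 2 minus twice the inner product, so it suffices that the inner product
    tends to 1. *)
Lemma circle_cvg (F : set_system circle) (FF : Filter F) z :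
  xc w @[w --> F] --> xc z -> yc w @[w --> F] --> yc z -> F --> z.
Proof.
move=> cx cy.
apply/cvg_ballP => e e0.
have hx : xc z * xc w + yc z * yc w @[w --> F] --> (1:R).
  rewrite -(circle_sqr z) !expr2; apply: cvgD; apply: cvgM => //; exact: cvg_cst.
near=> w.
rewrite ballEmdist /= -(@ltr_pXn2r _ 2) ?nnegrE ?mdist_ge0 ?(ltW e0) //.
rewrite circle_mdist_sqr.
have : 1 - e ^+ 2 / 2 < xc z * xc w + yc z * yc w.
  near: w; apply: cvgr_gt hx _ _.
  by rewrite ltrBlDr ltrDl divr_gt0 ?exprn_gt0.
move: (xc z * xc w + yc z * yc w) => u; lra.
Unshelve. all: by end_near. Qed.

Lemma cis_cont : continuous (@cis R).
Proof.
by move=> t; apply: circle_cvg; [exact: continuous_cos|exact: continuous_sin].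
Qed.

Lemma arg_cont z : z != cis 0 -> {for z, continuous arg}.
Proof.
move=> z1.
have nz : \forall w \near z, w != cis 0.
  have x1 := xc_lt1 z1.
  near=> w; apply/negP => /eqP w1.
  have : xc w < 1 by near: w; exact: (cvgr_lt _ (@xc_cont z)).
  by rewrite w1 xc_cis cos0 ltxx.
have az : arg z = pi - 2 * atan (yc z / (1 - xc z)) by rewrite /arg (negbTE z1).
change (arg w @[w --> z] --> arg z); rewrite az.
apply: (@cvg_trans _ (pi - 2 * atan (yc w / (1 - xc w)) @[w --> z])).
  apply: near_eq_cvg; near=> w; rewrite /arg ifN //; near: w; exact: nz.
have x1 : 1 - xc z != 0 by have := xc_lt1 z1; lra.
have gen (F : set_system circle) (FF : Filter F) :
    xc w @[w --> F] --> xc z -> yc w @[w --> F] --> yc z ->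
    pi - 2 * atan (yc w / (1 - xc w)) @[w --> F] --> pi - 2 * atan (yc z / (1 - xc z)).
  move=> cx cy; apply: cvgB; first exact: cvg_cst.
  apply: cvgM; first exact: cvg_cst.
  apply: (@cvg_comp _ _ _ (fun w => yc w / (1 - xc w)) atan _
    (nbhs (yc z / (1 - xc z)))); last exact: continuous_atan.
  by apply: cvgM => //; apply: cvgV => //; apply: cvgB => //; exact: cvg_cst.
exact: (gen _ (circle_nbhs_filter z) (@xc_cont z) (@yc_cont z)).
Unshelve. all: by end_near. Qed.

Lemma rotation_cis s t : rotation (cis s) (cis t) = cis (s + t).
Proof.
by apply: val_inj; rewrite /= cosD sinD; congr (_ +i* _)%C; ring.
Qed.

Lemma rotation_cont z : continuous (rotation z).
Proof.
move=> w; have xE v : xc (rotation z v) = xc z * xc v - yc z * yc v.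
  by rewrite /xc /yc /=; case: (val z) (val v) => [? ?] [].
have yE v : yc (rotation z v) = xc z * yc v + yc z * xc v.
  by rewrite /xc /yc /=; case: (val z) (val v) => [? ?] [].
have gen (F : set_system circle) (FF : Filter F) :
    xc v @[v --> F] --> xc w -> yc v @[v --> F] --> yc w ->
    rotation z v @[v --> F] --> rotation z w.
  move=> cx cy; apply: circle_cvg.
    change ((xc \o rotation z) v @[v --> F] --> xc (rotation z w)).
    have -> : xc \o rotation z = fun v => xc z * xc v - yc z * yc v by apply/funext.
    by rewrite xE; apply: cvgB; apply: cvgM => //; exact: cvg_cst.
  change ((yc \o rotation z) v @[v --> F] --> yc (rotation z w)).
  have -> : yc \o rotation z = fun v => xc z * yc v + yc z * xc v by apply/funext.
  by rewrite yE; apply: cvgD; apply: cvgM => //; exact: cvg_cst.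
exact: (gen _ (circle_nbhs_filter w) (@xc_cont w) (@yc_cont w)).
Qed.

Lemma rotation_cisK s : cancel (rotation (cis s)) (rotation (cis (- s))).
Proof.
by move=> z; rewrite -(argK z) !rotation_cis addrA addNr add0r.
Qed.

Lemma rotation_isometry z w v : mdist (rotation z w) (rotation z v) = mdist w v.
Proof.
rewrite -(argK z) -(argK w) -(argK v) !rotation_cis.
apply/eqP; rewrite -(@eqrXn2 _ 2) ?mdist_ge0 // !mdist_cis_sqr.
by apply/eqP; congr (_ - _ * cos _); ring.
Qed.

(** Rotating [cis t] to [cis pi] moves it away from [cis 0], the only point where [arg] may fail to
    be continuous. *)
Lemma cis_section t : exists f : circle -> R,
  [/\ {for cis t, continuous f}, f (cis t) = t & forall z, cis (f z) = z].
Proof.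
have p0 := @pi_gt0 R.
exists (fun z => (t - pi) + arg (rotation (cis (- (t - pi))) z)).
have e : rotation (cis (- (t - pi))) (cis t) = cis pi.
  by rewrite rotation_cis; congr cis; ring.
split.
- apply: cvgD; first exact: cvg_cst.
  apply: continuous_comp; first exact: rotation_cont.
  rewrite e; apply: arg_cont; apply: cis_neq1; lra.
- rewrite e arg_cis; lra.
- move=> z; rewrite -rotation_cis argK.
  by have := rotation_cisK (- (t - pi)) z; rewrite opprK.
Qed.

Lemma circle_compact : compact [set: circle].
Proof.
have -> : [set: circle] = @cis R @` `[0, T].
  apply/seteqP; split => // z _; exists (arg z); last exact: argK.
  by have /andP[h1 h2] := arg_itv z; rewrite /= in_itv /= h1 ltW.
apply: continuous_compact; last exact: segment_compact.
exact/continuous_subspaceT/cis_cont.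
Qed.

(** Although [arg] jumps at [cis 0], it differs from a section continuous at the given point by
    multiples of [T], which [g] ignores. *)
Lemma descend_cont (Y : topologicalType) (g : R -> Y) :
  continuous g -> (forall t, g (t + T) = g t) -> continuous (g \o arg).
Proof.
move=> cg gT z; rewrite /continuous_at /=.
have [f [cf ft fK]] := cis_section (arg z).
have E w : g (arg w) = g (f w).
  have [m ->] : exists m : int, arg w = f w + m%:~R * T.
    by apply: cis_eq; rewrite argK fK.
  by rewrite (periodicz gT).
rewrite argK in cf ft.
apply: (@cvg_trans _ (g (f w) @[w --> z])).
  by apply: near_eq_cvg; near=> w; rewrite -E.
rewrite E; apply: (@cvg_comp _ _ _ f g _ (nbhs (f z))); [exact: cf|exact: cg].
Unshelve. all: by end_near. Qed.

End argument.

(** * Lifts *)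

Section lifts.
Variable R : realType.
Local Notation T := (2 * pi : R).
Local Notation circle := (circle R).
Implicit Types (s t : R) (z w : circle).

(** Preimages of [L x - e] and [L x + e] bound a neighbourhood of [x] that [L] maps into the
    [e]-ball. *)
Lemma increasing_surj_cont (L : R -> R) :
  {homo L : s t / s < t} -> (forall y, exists x, L x = y) -> continuous L.
Proof.
move=> Li Ls x; rewrite /continuous_at; apply/cvgrPdist_lt => e e0.
have [x1 h1] := Ls (L x - e); have [x2 h2] := Ls (L x + e).
have Lle : {mono L : s t / s <= t} by apply: le_mono.
have x1x : x1 < x by rewrite -(leW_mono Lle) h1; lra.
have xx2 : x < x2 by rewrite -(leW_mono Lle) h2; lra.
near=> w.
have w1 : x1 < w by near: w; exact: lt_nbhsr.
have w2 : w < x2 by near: w; exact: lt_nbhsl.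
have := Li _ _ w1; have := Li _ _ w2; rewrite h1 h2 ltr_norml => *.
by apply/andP; split; lra.
Unshelve. all: by end_near. Qed.

Lemma increasing_surj_homeo (L : R -> R) :
  {homo L : s t / s < t} -> (forall y, exists x, L x = y) ->
  exists h : homeo R, homeo_fun h = L.
Proof.
move=> Li Ls; pose G y := sval (cid (Ls y)).
have LG : cancel G L by move=> y; rewrite /G; case: cid.
have Lle : {mono L : s t / s <= t} by apply: le_mono.
have GL : cancel L G by move=> x; apply: (inc_inj Lle); rewrite LG.
have Gi : {homo G : s t / s < t} by move=> s t st; rewrite -(leW_mono Lle) !LG.
have cG : continuous G by apply: increasing_surj_cont => // y; exists (L y).
by exists (Homeo GL LG (increasing_surj_cont Li Ls) cG).
Qed.

(** Equivariance makes [L] unbounded in both directions; intermediate values do the rest. *)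
Lemma equivariant_surj (L : R -> R) :
  continuous L -> (forall t, L (t + T) = L t + T) ->
  forall y, exists x, L x = y.
Proof.
move=> Lc LT y.
have T0 := period_gt0 R.
have Ln (n : nat) : L (n%:R * T) = L 0 + n%:R * T /\ L (- (n%:R * T)) = L 0 - n%:R * T.
  elim: n => [|n [IH1 IH2]]; first by rewrite !mul0r oppr0 !addr0.
  rewrite -addn1 natrD mulrDl mul1r LT IH1 addrA; split => //.
  have := LT (- (n%:R * T + T)); rewrite opprD addrNK IH2; lra.
have [n hn] : exists n : nat, `|y - L 0| <= n%:R * T.
  exists (Num.trunc (`|y - L 0| / T)).+1; rewrite -ler_pdivrMr //.
  exact/ltW/truncnS_gt.
move: hn; rewrite ler_norml => /andP[h1 h2]; have [e1 e2] := Ln n.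
have n0 : 0 <= n%:R * T by rewrite mulr_ge0 // ltW.
have [|||x _ hx] := @IVT R L (- (n%:R * T)) (n%:R * T) y; last by exists x.
- lra.
- exact: continuous_subspaceT.
- rewrite e1 e2 ge_min le_max; apply/andP; split; apply/orP; [left|right]; lra.
Qed.

(** Surjectivity stands in for continuity: with strict monotonicity it makes [L] a homeomorphism of
    the line. *)
Definition is_lift (f : circle -> circle) (L : R -> R) :=
  [/\ {homo L : s t / s < t}, (forall y, exists x, L x = y),
      (forall t, L (t + T) = L t + T) & forall t, f (cis t) = cis (L t)].

Lemma period_floor t (m : int) : 0 <= t - m%:~R * T < T -> Num.floor (t / T) = m.
Proof.
have T0 := period_gt0 R.
move=> /andP[h1 h2]; apply: floor_def.
by rewrite ler_pdivlMr // ltr_pdivrMr // intrD mulrDl mul1r; apply/andP; split; lra.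
Qed.

(* The lift is a strictly increasing bijection of [R], which makes it
   continuous without any gluing argument. *)
Lemma lift_of_increasing (g : circle -> circle) :
  injective g -> (forall z, exists w, g w = z) -> g (cis 0) = cis 0 ->
  {in `]0, T[ &, {homo (fun t => arg (g (cis t))) : s t / s < t}} ->
  exists L, is_lift g L.
Proof.
move=> gi gs g0 ginc; have T0 := period_gt0 R.
pose L t := (Num.floor (t / T))%:~R * T + arg (g (cis t)).
have LE t (m : int) : 0 <= t < T -> L (t + m%:~R * T) = m%:~R * T + arg (g (cis t)).
  by move=> h; rewrite /L cisDz (@period_floor _ m) // addrK.
have dec t : exists (m : int) r, 0 <= r < T /\ t = r + m%:~R * T.
  by have [m h] := modT_exists t; exists m, (t - m%:~R * T); rewrite subrK.
exists L; split.
- move=> s t; have [m [r [rT ->]]] := dec s; have [n [q [qT ->]]] := dec t.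
  rewrite !LE // => st.
  have /andP[a0 a1] := arg_itv (g (cis r)); have /andP[b0 b1] := arg_itv (g (cis q)).
  case/andP: (rT) => r0 r1; case/andP: (qT) => q0 q1.
  have [mn|nm|mn] := ltgtP m n.
  + have : (m + 1)%:~R * T <= n%:~R * T by rewrite ler_pM2r // ler_int; lia.
    by rewrite intrD mulrDl mul1r; lra.
  + have : (n + 1)%:~R * T <= m%:~R * T by rewrite ler_pM2r // ler_int; lia.
    by rewrite intrD mulrDl mul1r; lra.
  + subst n; rewrite ltrD2l; have rq : r < q by lra.
    (* [ginc] covers only the open interval; at 0 the argument is 0, and injectivity of [g] keeps it
       positive elsewhere. *)
    have [r00|rn] := eqVneq r 0.
      rewrite r00 g0 arg_cis0.
      suff /arg_itvoo/andP[] : g (cis q) != cis 0 by [].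
      rewrite -g0; apply/eqP => /gi; apply/eqP/cis_neq1; lra.
    have r0' : 0 < r by rewrite lt_neqAle eq_sym rn.
    by apply: ginc => //; rewrite in_itv /=; apply/andP; split => //; lra.
- move=> y; have [m [r [rT ->]]] := dec y.
  have [w hw] := gs (cis r).
  exists (arg w + m%:~R * T); rewrite LE ?arg_itv // argK hw arg_cis //.
  by rewrite addrC.
- move=> t; have [m [r [rT ->]]] := dec t.
  have -> : r + m%:~R * T + T = r + (m + 1)%:~R * T by rewrite intrD; ring.
  by rewrite !LE // intrD; ring.
- move=> t; have [m [r [rT ->]]] := dec t.
  by rewrite LE // [X in _ = cis X]addrC !cisDz argK.
Qed.

(** After a rotation [f] fixes [cis 0], and its argument becomes a continuous injection of an open
    interval, hence monotone. In the decreasing case [f] lifts to a decreasing map, which meets the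
    diagonal and whose square is increasing. *)
Lemma lift_dichotomy (f : homeo circle) :
  (exists L, is_lift f L) \/
  ((exists z, f z = z) /\ exists L, is_lift (f \o f) L).
Proof.
have T0 := period_gt0 R; have p0 := @pi_gt0 R.
pose c := arg (f (cis 0)).
pose g z := rotation (cis (- c)) (f z).
have gc : continuous g.
  by move=> z; apply: continuous_comp; [exact: homeo_cont|exact: rotation_cont].
have gi : injective g.
  by apply: inj_comp; [exact: can_inj (rotation_cisK (- c))|exact: homeo_inj].
have rK z : rotation (cis c) (rotation (cis (- c)) z) = z.
  by have := rotation_cisK (- c) z; rewrite opprK.
have fg z : f z = rotation (cis c) (g z) by rewrite /g rK.
have gs z : exists w, g w = z.
  exists (homeo_inv f (rotation (cis c) z)).
  by rewrite /g homeo_invK rotation_cisK.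
have g0 : g (cis 0) = cis 0.
  by rewrite /g -[f _]argK rotation_cis addNr.
have gn t : 0 < t < T -> g (cis t) != cis 0.
  by move=> /cis_neq1 h; rewrite -g0 (inj_eq gi).
pose psi t := arg (g (cis t)).
have psic : {within [set` `]0, T[], continuous psi}.
  apply/continuous_in_subspaceT => t; rewrite inE /= in_itv /= => tT.
  apply: (@continuous_comp R circle R (g \o @cis R) (@arg R) t).
    by apply: continuous_comp; [exact: cis_cont|exact: gc].
  by apply: arg_cont; exact: gn.
have psii : {in `]0, T[ &, injective psi}.
  move=> s t; rewrite !in_itv /= => /andP[s0 s1] /andP[t0 t1] /arg_inj/gi h.
  by rewrite -(@arg_cis _ s) ?(ltW s0) // h arg_cis // (ltW t0).
have I1 : (pi / 2) \in `]0, T[ by rewrite in_itv /=; apply/andP; split; lra.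
have I2 : (pi : R) \in `]0, T[ by rewrite in_itv /=; apply/andP; split; lra.
have I12 : (pi / 2 : R) < pi by lra.
(* Two sample points decide the direction of monotonicity. *)
have [le12|/ltW ge12] := leP (psi (pi / 2)) (psi pi).
- left.
  have mono : {in `]0, T[ &, {mono psi : x y / x <= y}}.
    by apply: itv_continuous_inj_le => //; exists (pi / 2), pi.
  have [|L [L1 L2 L3 L4]] := lift_of_increasing gi gs g0.
    by move=> s t sI tI st; rewrite (leW_mono_in mono).
  exists (fun t => c + L t); split.
  + by move=> s t st; rewrite ltrD2l L1.
  + by move=> y; have [x hx] := L2 (y - c); exists x; rewrite hx; ring.
  + by move=> t; rewrite L3 addrA.
  + by move=> t; rewrite fg L4 rotation_cis.
- right.
  have mono : {in `]0, T[ &, {mono psi : x y /~ x <= y}}.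
    by apply: itv_continuous_inj_ge => //; exists (pi / 2), pi.
  (* Complex conjugation turns the decreasing argument into an increasing one. *)
  pose cj z := cis (- arg z).
  have cjE t : cj (cis t) = cis (- t).
    by rewrite /cj; have [m ->] := cis_eq (argK (cis t)); rewrite opprD -mulNr -intrN cisDz.
  have cjK : involutive cj by move=> z; rewrite -(argK z) !cjE opprK.
  have [||||L [L1 L2 L3 L4]] := @lift_of_increasing (cj \o g).
  + exact: inj_comp (inv_inj cjK) gi.
  + by move=> z; have [w hw] := gs (cj z); exists w; rewrite /= hw cjK.
  + by rewrite /= g0 cjE oppr0.
  + move=> s t sI tI st /=.
    have E r : r \in `]0, T[ -> arg (cj (g (cis r))) = T - psi r.
      rewrite in_itv /= => /gn/arg_itvoo h.
      rewrite -[g _]argK cjE -[cis (- _)]cisDT arg_cis; first by rewrite addrC.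
      by move: h; rewrite -/(psi r) => /andP[]; move: (psi r) => u *; apply/andP; split; lra.
    by rewrite !E // ltrD2l ltrN2 (leW_nmono_in mono).
  have fE t : f (cis t) = cis (c - L t).
    by rewrite fg -[g _]cjK -[cj (g _)]/((cj \o g) _) L4 cjE rotation_cis.
  have LNT t : L (t - T) = L t - T by have := L3 (t - T); rewrite subrK; lra.
  split.
    (* A fixed point solves [x + L x = c]; halving makes the left side advance by exactly [T] per
       period. *)
    have [||x hx] := @equivariant_surj (fun t => t / 2 + L t / 2) _ _ (c / 2).
    - move=> t; apply: cvgD; apply: cvgM; try exact: cvg_cst; first exact: cvg_id.
      exact: increasing_surj_cont.
    - by move=> t; rewrite L3; lra.
    by exists (cis x); rewrite fE; congr cis; lra.
  exists (fun t => c - L (c - L t)); split.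
  + by move=> s t st; rewrite ltrD2l ltrN2 L1 // ltrD2l ltrN2 L1.
  + move=> y; have [x hx] := L2 (c - y); have [u hu] := L2 (c - x).
    by exists u; rewrite hu subKr hx subKr.
  + by move=> t; rewrite L3 opprD addrA LNT; ring.
  + by move=> t /=; rewrite !fE.
Qed.

End lifts.

(** * Sensitivity and stable points *)

Section sensitivity.
Context {R : realType} {X : pmetricType R}.
Implicit Types (f : homeo X) (mu : probability (borel X) R).

Lemma compact_unif_cont (Y : metricType R) (f : X -> Y) : compact [set: X] ->
  continuous f -> forall e : R, 0 < e -> exists2 d : R, 0 < d &
    forall x y, mdist x y < d -> mdist (f x) (f y) < e.
Proof.
move=> /compact_near_coveringP Xc fc e e0.
have /(filterI (nbhs_right_gt 0))/filter_ex[d [d0 H]] : \forall d \near (0:R)^'+,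
    [set: X] `<=` [set x | forall y, mdist x y < d -> mdist (f x) (f y) < e].
  apply: (Xc R (0^'+) (fun d x => forall y, mdist x y < d -> mdist (f x) (f y) < e)).
  move=> x _; have e2 : 0 < e / 2 by lra.
  have /nbhs_ballP[r /= r0 hr] := fc x _ (nbhsx_ballx (f x) _ e2).
  have fx y : mdist x y < r -> mdist (f x) (f y) < e / 2.
    by move=> xy; have := hr y; rewrite !ballEmdist; exact.
  exists (ball x (r / 2), [set d | 0 < d < r / 2]) => /=.
    split; first by apply: nbhsx_ballx; lra.
    near=> d; apply/andP; split; [by near: d; exact: nbhs_right_gt|].
    by near: d; apply: nbhs_right_lt; lra.
  move=> [x' d] /= [] ; rewrite ballEmdist /= => x'x /andP[d0 dr] y x'y.
  apply: (le_lt_trans (metric_triangle _ (f x) _)).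
  rewrite [e]splitr metric_sym ltrD // fx //.
    by apply: lt_trans x'x _; lra.
  by apply: (le_lt_trans (metric_triangle _ x' _)); lra.
by exists d => // x y; exact: H.
Unshelve. all: by end_near. Qed.

Definition small f (delta : R) (A : set X) := forall x y, A x -> A y ->
  forall n : int, mdist (homeo_iter f n x) (homeo_iter f n y) < delta.

(** The square of a small set lies in the exceptional null set, and its product measure is the
    square of [mu A]. *)
Lemma sensitive_small f mu : pairwise_sensitive f mu ->
  exists2 delta : R, 0 < delta &
    forall A : set X, measurable (A : set (borel X)) -> small f delta A -> mu A = 0%E.
Proof.
move=> [delta d0 [N [mN N0 hN]]]; exists delta => // A mA sA.
have AN : A `*` A `<=` N.
  move=> [x y] [/= Ax Ay]; apply: hN => /= -[n].
  by rewrite leNgt => /negP; apply; exact: sA.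
have : ((mu \x mu) (A `*` A) = 0)%E.
  apply/eqP; rewrite eq_le measure_ge0 andbT -N0.
  by apply: le_measure => //; rewrite inE //; exact: measurableX.
rewrite product_measure1E // => /eqP; rewrite mule_eq0 orbb => /eqP //.
Qed.

Lemma open_borel (U : set X) : open U -> measurable (U : set (borel X)).
Proof. exact: sub_sigma_algebra. Qed.

(** A compact metric space has a countable basis, so countably many null pieces cover [P]. *)
Lemma locally_null mu (P : set X) : compact [set: X] ->
  measurable (P : set (borel X)) ->
  (forall x, P x -> exists U : set X, [/\ open U, U x & mu (U `&` P) = 0%E]) ->
  mu P = 0%E.
Proof.
move=> Xc mP Pnull.
have [B cB [Bo Bn]] := compact_second_countable Xc.
have [h hB] := countable_injP _ cB.
pose C := [set V | B V /\ mu (V `&` P) = 0%E].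
(* As [h] is injective on [B], each union has at most one member; this indexes the basis by the
   naturals. *)
pose F n : set (borel X) := \bigcup_(V in [set V | C V /\ h V = n]) (V `&` P).
suff : mu.-negligible (\bigcup_n F n).
  move=> /negligibleS PN; apply: measure_negligible => //; apply: PN => x Px.
  have [U [oU Ux U0]] := Pnull x Px.
  have [V [BV Vx] VU] := Bn x U (open_nbhs_nbhs (conj oU Ux)).
  exists (h V) => //; exists V => //; split => //; split => //.
  apply/eqP; rewrite eq_le measure_ge0 andbT -U0; apply: le_measure.
  - by rewrite inE; apply: measurableI => //; exact: open_borel (Bo _ BV).
  - by rewrite inE; apply: measurableI => //; exact: open_borel.
  - by move=> y [Vy Py]; split => //; exact: VU.
apply: negligible_bigcup => n.
have [[V [[BV V0] hV]]|noV] := pselect (exists V, C V /\ h V = n).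
  exists (V `&` P); split => //.
    by apply: measurableI => //; exact: open_borel (Bo _ BV).
  move=> x [W [[BW _] hW] [Wx Px]]; split => //.
  by have <- : W = V by apply: hB; [exact: mem_set|exact: mem_set|rewrite hW hV].
have -> : F n = set0.
  by apply/seteqP; split => // x [V VP _]; case: noV; exists V.
exact: negligible_set0.
Qed.

(** The iterates of [f] up to [N] are uniformly continuous with a common [eta], so pairs kept
    [eta]-close by the power are kept [delta]-close by [f]. The same exceptional set serves. *)
Lemma sensitive_pow f mu (N : nat) : compact [set: X] ->
  pairwise_sensitive f mu -> pairwise_sensitive (homeo_pow f N.+1) mu.
Proof.
move=> Xc [delta d0 [A [mA A0 hA]]].
have [eta e0 he] : exists2 eta : R, 0 < eta & forall (j : 'I_N.+1) x y,
    mdist x y < eta -> mdist (iter j f x) (iter j f y) < delta.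
  have H (j : 'I_N.+1) : \forall eta \near (0:R)^'+, forall x y,
      mdist x y < eta -> mdist (iter j f x) (iter j f y) < delta.
    have [eta e0 he] := compact_unif_cont Xc (homeo_iter_cont (f := f) (n := j)) d0.
    near=> e => x y xy; apply: he; apply: lt_trans xy _.
    by near: e; exact: nbhs_right_lt.
  near (0:R)^'+ => eta; exists eta; near: eta; first exact: nbhs_right_gt.
  exact: filter_forall.
exists eta => //; exists A; split => // p hp; apply: hA => -[n hn]; apply: hp.
exists (n %/ N.+1)%Z; rewrite !homeo_iter_pow leNgt; apply/negP => lt.
have r0 : (0 <= n %% N.+1)%Z by exact: modz_ge0.
have rN : (`|(n %% N.+1)%Z| < N.+1)%N.
  by rewrite -ltz_nat gez0_abs // ltz_pmod.
have := he (Ordinal rN) _ _ lt; apply/negP; rewrite -leNgt /=.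
suff E x : iter `|(n %% N.+1)%Z| f (homeo_iter f ((n %/ N.+1)%Z * N.+1) x) = homeo_iter f n x.
  by rewrite !E.
rewrite -[LHS]/(homeo_iter f `|(n %% N.+1)%Z| _) -homeo_iterD; congr (homeo_iter f _ _).
by rewrite ger0_norm // addrC -divz_eq.
Unshelve. all: by end_near. Qed.

(** Lyapunov stability in both time directions: one neighbourhood serves all [n]. *)
Definition stable f x := forall e : R, 0 < e ->
  \forall y \near x, forall n : int, mdist (homeo_iter f n x) (homeo_iter f n y) < e.

(** The fixed set and its complement are both locally null: fixed points stay at their initial
    distance, the others are stable. The total mass would be 0. *)
Lemma not_sensitive f mu : compact [set: X] ->
  (forall x, f x <> x -> stable f x) -> ~ pairwise_sensitive f mu.
Proof.
move=> Xc st /sensitive_small[delta d0 small0].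
pose K := [set x | f x = x].
have oK : open (~` K).
  rewrite openE => x /= /eqP fx; rewrite -mdist_gt0 in fx.
  set d := mdist _ _ in fx.
  have h1 : \forall y \near x, ball (f x) (d / 2) (f y).
    by apply: (homeo_cont (h := f)); apply: nbhsx_ballx; lra.
  have h2 : \forall y \near x, ball x (d / 2) y by apply: nbhsx_ballx; lra.
  rewrite /interior; near=> y => /= fy.
  have : ball (f x) (d / 2) (f y) by near: y.
  have : ball x (d / 2) y by near: y.
  rewrite !ballEmdist /= fy => a b.
  have := metric_triangle (f x) y x; rewrite -/d [mdist y x]metric_sym; lra.
have mKC : measurable (~` K : set (borel X)) by exact: open_borel.
have mK : measurable (K : set (borel X)) by rewrite -(setCK K); exact: measurableC.
have iterK n x : K x -> homeo_iter f n x = x.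
  move=> Kx; elim/int_ind: n => // n IH.
    by rewrite -addn1 PoszD homeo_iter_succ IH.
  apply: (@homeo_inj _ f); rewrite -homeo_iter_succ Kx -[RHS]IH; congr homeo_iter; lia.
have K0 : mu K = 0%E.
  apply: locally_null => // x Kx.
  have : nbhs x (ball x (delta / 2)) by apply: nbhsx_ballx; lra.
  rewrite nbhsE => -[U [oU Ux] Ub]; exists U; split => //.
  apply: small0; first by apply: measurableI => //; exact: open_borel.
  move=> y z [/Ub yb Ky] [/Ub zb Kz] n; rewrite !iterK //.
  move: yb zb; rewrite ballEmdist /= => a b.
  have := metric_triangle y x z; rewrite [mdist y x]metric_sym; lra.
have KC0 : mu (~` K) = 0%E.
  apply: locally_null => // x Kx.
  have : nbhs x [set y | forall n, mdist (homeo_iter f n x) (homeo_iter f n y) < delta / 2].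
    by apply: (st _ Kx); lra.
  rewrite nbhsE => -[U [oU Ux] Us]; exists U; split => //.
  apply: small0; first by apply: measurableI => //; exact: open_borel.
  move=> y z [/Us ys _] [/Us zs _] n.
  have := metric_triangle (homeo_iter f n y) (homeo_iter f n x) (homeo_iter f n z).
  rewrite [mdist _ (homeo_iter f n x)]metric_sym; have := ys n; have := zs n; lra.
have : (mu [set: X] = mu K + mu (~` K))%E.
  by rewrite -(setUv K); apply: measureU => //; exact: setICr.
by rewrite K0 KC0 adde0 probability_setT => /eqP; rewrite onee_eq0.
Unshelve. all: by end_near. Qed.

End sensitivity.

(** * Sensitive homeomorphisms are Denjoy *)

Section lifted_dynamics.
Variable R : realType.
Local Notation T := (2 * pi : R).
Local Notation circle := (circle R).
Implicit Types (s t : R) (x y z : circle) (f : homeo circle) (H : homeo R).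

Lemma negzS (n : nat) : - n.+1%:Z + 1 = - n%:Z.
Proof. by lia. Qed.

Lemma lift_homeo (f : circle -> circle) (L : R -> R) : is_lift f L ->
  exists H, is_lift f H.
Proof.
move=> fL; have [L1 L2 _ _] := fL.
by have [H HL] := increasing_surj_homeo L1 L2; exists H; rewrite HL.
Qed.

Lemma lift_iter f H : is_lift f H -> forall (n : int) t,
  homeo_iter f n (cis t) = cis (homeo_iter H n t).
Proof.
move=> [_ _ _ fH]; elim/int_ind => // n IH t.
  by rewrite -[n.+1]addn1 PoszD !homeo_iter_succ IH fH.
apply: (@homeo_inj _ f); rewrite fH -!homeo_iter_succ.
by rewrite negzS.
Qed.

Lemma lift_iter_incr f H : is_lift f H -> forall n : int,
  {homo homeo_iter H n : s t / s < t}.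
Proof.
move=> [Hi _ _ _]; have Hle : {mono H : s t / s <= t} by apply: le_mono.
elim/int_ind => // n IH s t st.
  by rewrite -[n.+1]addn1 PoszD !homeo_iter_succ Hi // IH.
rewrite -(leW_mono Hle) -!homeo_iter_succ.
by rewrite negzS; exact: IH.
Qed.

Lemma liftDz f H : is_lift f H -> forall t (m : int), H (t + m%:~R * T) = H t + m%:~R * T.
Proof.
move=> [_ _ HT _] t m.
suff : H (t + m%:~R * T) - (t + m%:~R * T) = H t - t by lra.
by apply: (@periodicz _ _ (fun t => H t - t)) => u; rewrite HT; ring.
Qed.

Lemma lift_iterDz f H : is_lift f H -> forall (n : int) t (m : int),
  homeo_iter H n (t + m%:~R * T) = homeo_iter H n t + m%:~R * T.
Proof.
move=> fH; elim/int_ind => // n IH t m.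
  by rewrite -[n.+1]addn1 PoszD !homeo_iter_succ IH (liftDz fH).
apply: (@homeo_inj _ H); rewrite (liftDz fH) -!homeo_iter_succ.
by rewrite negzS.
Qed.

(** Rotations are isometries, so continuity at 0 is already uniform. *)
Lemma cis_unif_cont (e : R) : 0 < e ->
  exists2 d : R, 0 < d & forall s t, `|s - t| < d -> mdist (cis s) (cis t) < e.
Proof.
move=> e0; have /nbhs_ballP[d /= d0 hd] := @cis_cont R 0 _ (nbhsx_ballx (cis 0) e e0).
exists d => // s t st.
rewrite -(rotation_isometry (cis (- s))) !rotation_cis addNr.
have /hd : ball (0 : R) d (- s + t) by rewrite /ball /= sub0r opprD opprK.
by rewrite /= ballEmdist.
Qed.

(** The orbit is monotone and confined to [[p, q]], hence convergent. *)
Lemma orbit_gap (L : R -> R) p q s : {homo L : s t / s <= t} ->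
  L p = p -> L q = q -> p <= s <= q ->
  forall e : R, 0 < e -> \forall n \near \oo, `|iter n.+1 L s - iter n L s| < e.
Proof.
move=> Li Lp Lq /andP[ps sq] e e0; pose u n := iter n L s.
have pu n : p <= u n by elim: n => // n IH; rewrite /= -[p]Lp Li.
have uq n : u n <= q by elim: n => // n IH; rewrite /= -[q]Lq Li.
have cu : cvgn u.
  have [sL|/ltW sL] := leP s (L s).
    apply: nondecreasing_is_cvgn; last by exists q => _ [n _ <-].
    by apply/nondecreasing_seqP; elim => // n IH; exact: Li.
  apply: nonincreasing_is_cvgn; last by exists p => _ [n _ <-].
  by apply/nonincreasing_seqP; elim => // n IH; exact: Li.
have : (fun n => u n.+1 - u n) @ \oo --> (0 : R).
  rewrite -(subrr (limn u)); apply: cvgB => //.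
  by rewrite -(@cvg_shiftS _ u) in cu.
move=> /cvgrPdist_lt/(_ e e0); apply: filterS => n.
by rewrite sub0r normrN.
Qed.

(* The iterates of the interval between [s] and [H s], which contains [t], have
   lengths tending to [0] in both time directions; the finitely many remaining
   iterates are handled by continuity at [t]. *)
Lemma lift_fixed_stable f H t0 : is_lift f H -> H t0 = t0 ->
  forall x, f x <> x -> stable f x.
Proof.
move=> fH Ht0 x; rewrite -(argK x); move: (arg x) => t; move: (fH) => [Hi Hs _ fcis].
rewrite fcis => cneq.
have Hneq : H t != t by apply/eqP => h; rewrite h in cneq.
have Hle : {mono H : s t / s <= t} by apply: le_mono.
have Hwle : {homo H : s t / s <= t} by move=> a b; rewrite Hle.
have HIle : {homo homeo_inv H : s t / s <= t} by move=> a b ab; rewrite -Hle !homeo_invK.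
(* The midpoint of [t] and its preimage works, whichever way [H] moves [t]. *)
have [s sP] : exists s, Num.min s (H s) < t < Num.max s (H s).
  have [tH|Ht|e] := ltgtP t (H t); last by rewrite -e eqxx in Hneq.
    have h : homeo_inv H t < t by rewrite -(leW_mono Hle) homeo_invK.
    exists ((homeo_inv H t + t) / 2).
    have h1 : (homeo_inv H t + t) / 2 < t by lra.
    have h2 : t < H ((homeo_inv H t + t) / 2).
      by rewrite -[X in X < _](homeo_invK H) (leW_mono Hle); lra.
    by rewrite gt_min lt_max h1 h2 orbT.
  have h : t < homeo_inv H t by rewrite -(leW_mono Hle) homeo_invK.
  exists ((homeo_inv H t + t) / 2).
  have h1 : t < (homeo_inv H t + t) / 2 by lra.
  have h2 : H ((homeo_inv H t + t) / 2) < t.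
    by rewrite -[X in _ < X](homeo_invK H) (leW_mono Hle); lra.
  by rewrite gt_min lt_max h1 h2 orbT.
(* [p] and [q] are consecutive translates of the fixed point [t0] enclosing [s]. *)
have [m mP] := modT_exists (s - t0).
pose p := t0 + m%:~R * T; pose q := t0 + (m + 1)%:~R * T.
have Hp : H p = p by rewrite (liftDz fH) Ht0.
have Hq : H q = q by rewrite (liftDz fH) Ht0.
have psq : p <= s <= q.
  by rewrite /p /q intrD mulrDl mul1r; apply/andP; split; lra.
have HIp : homeo_inv H p = p by rewrite -[X in homeo_inv _ X]Hp homeo_funK.
have HIq : homeo_inv H q = q by rewrite -[X in homeo_inv _ X]Hq homeo_funK.
move=> e e0; have [d d0 hd] := cis_unif_cont e0.
have [N1 _ g1] := orbit_gap Hwle Hp Hq psq d0.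
have [N2 _ g2] := orbit_gap HIle HIp HIq psq d0.
pose N := maxn N1 N2.
have gap a b n : Num.min s (H s) < a < Num.max s (H s) ->
    Num.min s (H s) < b < Num.max s (H s) ->
    `|homeo_iter H n a - homeo_iter H n b| <=
    `|homeo_iter H n (H s) - homeo_iter H n s|.
  have Ii := @lift_iter_incr _ _ fH n; rewrite !gt_min !lt_max.
  have [sH|Hs'|e'] := ltgtP s (H s); last by rewrite -e' !orbb => /andP[a1 a2]; lra.
    move=> /andP[a1 a2] /andP[b1 b2].
    have {}a1 : s < a by case/orP: a1 => // /(lt_trans sH).
    have {}b1 : s < b by case/orP: b1 => // /(lt_trans sH).
    have {}a2 : a < H s by case/orP: a2 => // /lt_trans/(_ sH).
    have {}b2 : b < H s by case/orP: b2 => // /lt_trans/(_ sH).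
    have := Ii _ _ a1; have := Ii _ _ a2; have := Ii _ _ b1; have := Ii _ _ b2.
    rewrite [X in _ -> _ -> _ -> _ -> _ <= X]ger0_norm ?subr_ge0; last exact/ltW/Ii.
    by rewrite ler_norml => *; apply/andP; split; lra.
  move=> /andP[a1 a2] /andP[b1 b2].
  have {}a1 : H s < a by case/orP: a1 => // /(lt_trans Hs').
  have {}b1 : H s < b by case/orP: b1 => // /(lt_trans Hs').
  have {}a2 : a < s by case/orP: a2 => // /lt_trans/(_ Hs').
  have {}b2 : b < s by case/orP: b2 => // /lt_trans/(_ Hs').
  have := Ii _ _ a1; have := Ii _ _ a2; have := Ii _ _ b1; have := Ii _ _ b2.
  rewrite [X in _ -> _ -> _ -> _ -> _ <= X]ler0_norm ?subr_le0; last exact/ltW/Ii.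
  by rewrite ler_norml => *; apply/andP; split; lra.
have big n : (N < `|n|)%N -> `|homeo_iter H n (H s) - homeo_iter H n s| < d.
  rewrite gtn_max => /andP[n1 n2].
  case: n n1 n2 => n n1 n2.
    by rewrite -[homeo_iter H n (H s)]iterSr; apply: g1; exact: ltnW.
  (* In negative time [H s] cancels one inverse, leaving the iterates [n] and [n.+1] of
     [homeo_inv H] at [s]. *)
  rewrite distrC.
  rewrite -[homeo_iter H (Negz n) (H s)]/(iter n.+1 (homeo_inv H) (H s)) iterSr homeo_funK.
  exact: g2.
have near_t : \forall t' \near t, forall n, `|homeo_iter H n t - homeo_iter H n t'| < d.
  have fin (i : 'I_(N.*2.+1)) : \forall t' \near t,
      `|homeo_iter H (i%:Z - N%:Z) t - homeo_iter H (i%:Z - N%:Z) t'| < d.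
    have := @homeo_iter_cont _ H (i%:Z - N%:Z) t.
    by rewrite /continuous_at => /cvgrPdist_lt; exact.
  have /andP[sl sr] := sP.
  near=> t' => n.
  have [nN|Nn] := leqP `|n| N; last first.
    apply: le_lt_trans (big _ Nn); apply: gap => //.
    apply/andP; split.
      by near: t'; exact: (lt_nbhsr sl).
    by near: t'; exact: (lt_nbhsl sr).
  have nP : (`|(n + N%:Z)%R|%N < N.*2.+1)%N by lia.
  have -> : n = (Ordinal nP)%:Z - N%:Z by rewrite /=; lia.
  move: (Ordinal nP); near: t'; exact: (filter_forall _ fin).
have [sig [sc st sK]] := cis_section t.
have : \forall y \near cis t, forall n, `|homeo_iter H n t - homeo_iter H n (sig y)| < d.
  have : nbhs (sig (cis t)) [set t' | forall n, `|homeo_iter H n t - homeo_iter H n t'| < d].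
    by rewrite st.
  exact: sc.
apply: filterS => y hy n; rewrite -[y]sK !(lift_iter fH); exact: hd.
Unshelve. all: by end_near. Qed.

(** Rotations preserve distances, and uniform continuity of the inverse conjugacy carries closeness
    back for all [n] at once. *)
Lemma conj_rotation_stable f a : conjugate f (rotation a) -> forall x, stable f x.
Proof.
move=> [h hf] x e e0.
have hfi (n : int) y : h (homeo_iter f n y) = rotation (cis (n%:~R * arg a)) (h y).
  elim/int_ind: n y => [|n IH|n IH] y.
  - by rewrite mul0r -[h y]argK rotation_cis add0r.
  - rewrite -[n.+1]addn1 PoszD homeo_iter_succ hf IH.
    rewrite -(argK a) -[h y]argK !rotation_cis argK intrD.
    by congr cis; ring.
  - have := IH y; rewrite -negzS
      homeo_iter_succ hf -[h (homeo_iter _ _ _)]argK.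
    rewrite -[X in rotation X](argK a) -[h y]argK !rotation_cis.
    move=> /(congr1 (rotation (cis (- arg a)))); rewrite !rotation_cis intrD => E.
    rewrite -[LHS]/(cis (arg _)).
    by rewrite -[arg (h (homeo_iter _ _ _))](addKr (arg a)) E; congr cis; ring.
have [d d0 hd] := compact_unif_cont (@circle_compact R) (homeo_inv_cont (h := h)) e0.
have : \forall y \near x, ball (h x) d (h y).
  by apply: (homeo_cont (h := h)); exact: nbhsx_ballx.
apply: filterS => y; rewrite ballEmdist /= => xy n.
rewrite -[homeo_iter f n x](homeo_funK h) -[homeo_iter f n y](homeo_funK h); apply: hd.
by rewrite !hfi rotation_isometry.
Qed.

Lemma sensitive_denjoy f (mu : probability (borel circle) R) :
  pairwise_sensitive f mu -> denjoy f.
Proof.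
move=> fmu; have Xc := @circle_compact R.
have fixed_contra (N : nat) L z : is_lift (homeo_pow f N.+1) L ->
    homeo_pow f N.+1 z = z -> False.
  move=> /lift_homeo[H gH] fz; move: (gH) => [H1 H2 H3 H4].
  (* Subtracting this multiple of [T] gives another lift, which fixes [arg z]. *)
  have [m hm] : exists m : int, H (arg z) = arg z + m%:~R * T.
    by apply: cis_eq; rewrite -H4 argK.
  have gH' : is_lift (homeo_pow f N.+1) (fun t => H t - m%:~R * T).
    split.
    - by move=> s t st; rewrite ltrD2r H1.
    - by move=> y; have [u hu] := H2 (y + m%:~R * T); exists u; rewrite hu addrK.
    - by move=> t; rewrite H3 addrAC.
    - by move=> t; rewrite H4 -[cis (_ - _)](cisDz _ m) subrK.
  have [K HK] := increasing_surj_homeo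
    (let: And4 a _ _ _ := gH' in a)
    (let: And4 _ b _ _ := gH' in b).
  rewrite -HK in gH'.
  apply: (@not_sensitive _ _ (homeo_pow f N.+1) mu Xc); last exact: sensitive_pow.
  by apply: (lift_fixed_stable gH' (t0 := arg z)); rewrite HK hm addrK.
have pow1 z : homeo_pow f 1 z = f z by [].
have pow2 z : homeo_pow f 2 z = f (f z) by [].
have noper L : is_lift f L -> forall z, ~ periodic_point f z.
  move=> /lift_homeo[H fH] z [n fz].
  apply: (@fixed_contra n (homeo_iter H n.+1) z) => //; split.
  - exact: lift_iter_incr fH _.
  - by move=> y; exists (homeo_iter H (- n.+1%:Z) y); rewrite homeo_iterN.
  - by move=> t; have := lift_iterDz fH n.+1 t 1; rewrite !mul1r.
  - by move=> t; rewrite -(lift_iter fH).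
(* In the reversing case the fixed point of [f] is also fixed by its square, which has an increasing
   lift. *)
have [[L fL]|[[z fz] [L fL]]] := lift_dichotomy f; last first.
  by case: (@fixed_contra 1%N L z) => //; rewrite pow2 !fz.
split.
- have [L1 L2 L3 L4] := fL; exists L; split => //; exact: increasing_surj_cont.
- exact: noper fL.
- move=> [a fa]; apply: (@not_sensitive _ _ f mu Xc) => // x _.
  exact: conj_rotation_stable fa x.
Qed.

End lifted_dynamics.

(** * The order of an orbit *)

Section rotation_order.
Variable R : realType.
Local Notation T := (2 * pi : R).
Variables (f : homeo (circle R)) (H : homeo R).
Hypothesis fH : is_lift f H.
Hypothesis noper : forall z, ~ periodic_point f z.
Implicit Types (s t : R) (a b : int * int).

Lemma pair_mulz a (k : int) : a *~ k = (a.1 * k, a.2 * k).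
Proof.
have pos (b : int * int) (n : nat) : b *+ n = (b.1 * n%:Z, b.2 * n%:Z).
  case: b => x y; elim: n => [|n IH]; first by rewrite /= !mulr0.
  by rewrite mulrSr IH /= -[n.+1]addn1 PoszD !mulrDr !mulr1.
case: k => n; first exact: pos.
by rewrite NegzE mulrNz -pmulrn pos /= !mulrN.
Qed.

Lemma pair_muln a (k : nat) : a *+ k = (a.1 * k%:Z, a.2 * k%:Z).
Proof. exact: (pair_mulz a k). Qed.

(** The action of the group of integer pairs generated by [H] and the translation by [T], which
    commute. *)
Definition act a t : R := homeo_iter H a.1 t + a.2%:~R * T.

Lemma act0 t : act 0 t = t.
Proof. by rewrite /act mul0r addr0. Qed.

Lemma actD a b t : act (a + b) t = act a (act b t).
Proof.
by rewrite /act /= homeo_iterD (lift_iterDz fH) intrD; ring.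
Qed.

Lemma actNK a : cancel (act (- a)) (act a).
Proof. by move=> t; rewrite -actD subrr act0. Qed.

Lemma act_lt a : {mono act a : s t / s < t}.
Proof.
by apply: leW_mono; apply: le_mono => s t st; rewrite ltrD2r (lift_iter_incr fH).
Qed.

Lemma act_le a : {mono act a : s t / s <= t}.
Proof. by move=> s t; rewrite !leNgt act_lt. Qed.

(** A fixed point projects to a periodic point of [f], unless [a] acts as a nontrivial
    translation. *)
Lemma act_free a t : a != 0 -> act a t != t.
Proof.
case: a => n m nm0; apply/eqP; have T0 := period_gt0 R.
have pos k s p : act (Posz k.+1, p) s <> s.
  move=> e; apply: (noper (z := cis s)); exists k.
  rewrite -[LHS]/(homeo_iter f k.+1 _) (lift_iter fH).
  by rewrite -(cisDz _ p) -/(act (_, p) s) e.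
case: n nm0 => [[|n]|n] nm0.
- rewrite /act /= => /eqP.
  rewrite eq_sym addrC -subr_eq subrr eq_sym mulf_eq0 intr_eq0 (gt_eqF T0) orbF.
  by move=> /eqP m0; rewrite m0 in nm0.
- exact: pos.
- move=> e; apply: (pos n t (- m)); rewrite -[X in act _ X]e -actD.
  by rewrite -[RHS](act0) -[RHS]act0 act0 /act /=; rewrite NegzE subrr addNr mul0r addr0.
Qed.

(** Otherwise the supremum of the orbit is either fixed by [act a], against freeness, or overtaken
    by the image of a nearby orbit point. *)
Lemma act_iter_unbounded a : 0 < act a 0 -> exists k : nat, T < act (a *+ k) 0.
Proof.
move=> a0; apply: contrapT => nk.
pose S := range (fun k : nat => act (a *+ k) 0).
have bS : ubound S T.
  by move=> _ [k _ <-]; rewrite leNgt; apply/negP => h; apply: nk; exists k.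
have S0 : S 0 by exists 0%N; rewrite // mulr0n act0.
have hS : has_sup S by split; [exists 0|exists T].
have an0 : a != 0 by apply: contraTneq a0 => ->; rewrite act0 ltxx.
have Sa x : S x -> S (act a x).
  by move=> [k _ <-]; exists k.+1; rewrite // mulrS actD.
have [le|gt] := leP (sup S) (act (- a) (sup S)).
  have le1 : act a (sup S) <= sup S by rewrite -[X in _ <= X](actNK a) act_le.
  have : sup S <= act a (sup S).
    apply: ge_sup; first by exists 0.
    move=> _ [k _ <-]; apply: (@le_trans _ _ (act (a *+ k.+1) 0)).
      by rewrite mulrSr actD act_le ltW.
    by rewrite mulrS actD act_le; apply: sup_upper_bound => //; exists k.
  move=> le2; have := act_free (sup S) an0.
  by rewrite eq_le le1 le2.
have d0 : 0 < sup S - act (- a) (sup S) by lra.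
have [x Sx] := sup_adherent d0 hS.
rewrite opprB addrC subrK => ltx.
have : sup S < act a x by rewrite -[X in X < _](actNK a) act_lt.
by rewrite ltNge sup_upper_bound //; exact: Sa.
Qed.

Lemma act_iter_ge0 a k : 0 < act a 0 -> 0 <= act (a *+ k) 0.
Proof.
move=> a0; elim: k => [|k IH]; first by rewrite mulr0n act0.
by rewrite mulrSr actD; apply: le_trans IH _; rewrite act_le ltW.
Qed.

Lemma act_iter_le0 a k : act a 0 < 0 -> act (a *+ k) 0 <= 0.
Proof.
move=> a0; elim: k => [|k IH]; first by rewrite mulr0n act0.
by rewrite mulrSr actD; apply: le_trans IH; rewrite act_le ltW.
Qed.

Lemma actN_gt0 a : (0 < act (- a) 0) = (act a 0 < 0).
Proof. by rewrite -[LHS](act_lt a) actNK. Qed.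

(** What [act a 0] would be if [H] were the translation by [alpha]. *)
Definition lin (alpha : R) a : R := a.1%:~R * alpha + a.2%:~R * T.

Lemma linD alpha a b : lin alpha (a + b) = lin alpha a + lin alpha b.
Proof. by rewrite /lin /= !intrD; ring. Qed.

Lemma linN alpha a : lin alpha (- a) = - lin alpha a.
Proof. by rewrite /lin /= !intrN; ring. Qed.

Lemma lin0 alpha : lin alpha 0 = 0.
Proof. by rewrite /lin /= !mul0r addr0. Qed.

Lemma linMn alpha a k : lin alpha (a *+ k) = k%:R * lin alpha a.
Proof.
elim: k => [|k IH]; first by rewrite mulr0n lin0 mul0r.
by rewrite mulrSr linD IH -[k.+1]addn1 natrD mulrDl mul1r.
Qed.

Lemma linMz alpha a (k : int) : lin alpha (a *~ k) = k%:~R * lin alpha a.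
Proof.
case: k => k; first exact: linMn.
by rewrite NegzE mulrNz linN linMn intrN mulNr.
Qed.

Lemma translation_number : exists alpha : R,
  forall a, 0 < act a 0 -> 0 < lin alpha a.
Proof.
have T0 := period_gt0 R.
(* [act a 0 > 0] should mean [alpha > - a.2 T / a.1] when [a.1 > 0]. *)
pose S := [set x | exists a, [/\ 0 < a.1, 0 < act a 0 & x = - (a.2%:~R * T) / a.1%:~R]].
(* Multiplying each pair by the first component of the other gives the same iterate of [H], so only
   the translations are compared. *)
have cmp a b : 0 < a.1 -> 0 < act a 0 -> 0 < b.1 -> act b 0 < 0 ->
    - (a.2%:~R * T) / a.1%:~R <= - (b.2%:~R * T) / b.1%:~R.
  case: a b => [[n|//] m] [[q|//] p] /= n0 a0 q0 b0.
  rewrite ler_pdivrMr ?ltr0z // mulrAC ler_pdivlMr ?ltr0z //.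
  have h1 := act_iter_ge0 q a0.
  have h2 := act_iter_le0 n b0.
  move: (le_trans h2 h1); rewrite /act !pair_muln /= mulnC lerD2l !intrM => h.
  by move: h; rewrite -!pmulrn => h; lra.
(* Then [(1, M)] moves 0 up and [(1, - M)] moves it down, so [S] is nonempty and bounded above. *)
have [M hM] : exists M : nat, `|act (1, 0) 0| < M%:R * T.
  exists (Num.trunc (`|act (1, 0) 0| / T)).+1; rewrite -ltr_pdivrMr //.
  exact/truncnS_gt.
have act1 m : act (1, m) 0 = act (1, 0) 0 + m%:~R * T by rewrite /act mul0r addr0.
move: hM; rewrite ltr_norml => /andP[M1 M2].
have hS : has_sup S.
  split.
    exists (- ((M%:Z)%:~R * T) / 1%:~R), (1, M%:Z); split => //=; rewrite act1 /=.
    by rewrite -[X in X%:~R]/(M%:Z) -pmulrn; lra.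
  exists (- ((- M%:Z)%:~R * T) / 1%:~R) => x [a [a1 a0 ->]].
  apply: (cmp a (1, - M%:Z)) => //; rewrite act1 intrN -pmulrn; lra.
exists (sup S) => a a0.
have ub b : 0 < b.1 -> 0 < act b 0 -> 0 <= lin (sup S) b.
  move=> b1 b0; have : - (b.2%:~R * T) / b.1%:~R <= sup S.
    by apply: sup_upper_bound => //; exists b.
  by rewrite ler_pdivrMr ?ltr0z // /lin; lra.
have lb b : 0 < b.1 -> act b 0 < 0 -> lin (sup S) b <= 0.
  move=> b1 b0; have : sup S <= - (b.2%:~R * T) / b.1%:~R.
    by apply: ge_sup; [exact: hS.1|move=> x [c [c1 c0 ->]]; exact: cmp].
  by rewrite ler_pdivlMr ?ltr0z // /lin; lra.
(* The cut gives only weak inequalities. As [act (a *+ k) 0] exceeds [T], one period can be given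
   away, so [k%:R * lin (sup S) a] is at least [T] when [a.1] is nonzero. *)
have [k hk] := act_iter_unbounded a0.
have k0 : (0 < k)%N by case: k hk => //; rewrite mulr0n act0 => h; lra.
have shift b m : act (b + (0, m)) 0 = act b 0 + m%:~R * T.
  by rewrite /act /= addr0 intrD mulrDl addrA.
have lin_shift m : lin (sup S) (0, m) = m%:~R * T by rewrite /lin mul0r add0r.
have [n0|n0|n0] := ltgtP a.1 0.
- have : lin (sup S) (- (a *+ k) + (0, 1)) <= 0.
    apply: lb.
      by rewrite pair_muln /=; nia.
    rewrite -(act_lt (a *+ k)) -actD addrA subrr add0r.
    by rewrite /act /= mul1r add0r.
  rewrite linD linN linMn lin_shift mul1r => h.
  have : 0 < k%:R * lin (sup S) a by lra.
  by rewrite pmulr_rgt0 // ltr0n.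
- have : 0 <= lin (sup S) (a *+ k + (0, -1)).
    apply: ub; first by rewrite pair_muln /=; nia.
    by rewrite shift mulN1r; lra.
  rewrite linD linMn lin_shift mulN1r => h.
  have : 0 < k%:R * lin (sup S) a by lra.
  by rewrite pmulr_rgt0 // ltr0n.
- by move: a0; rewrite /lin /act n0 /= mul0r.
Qed.

(** * Density of the linear form and the inverse semiconjugacy *)

Section with_translation_number.
Variable alpha : R.
Hypothesis alphaP : forall a, 0 < act a 0 -> 0 < lin alpha a.

(** For the converse of [alphaP], freeness excludes the value 0 and [alphaP] at [- a] excludes
    negative values. *)
Lemma lin_gt0 a : (0 < lin alpha a) = (0 < act a 0).
Proof.
apply/idP/idP; last exact: alphaP.
move=> l0; rewrite ltNge le_eqVlt negb_or; apply/andP; split.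
  apply/eqP => a0; have : a = 0.
    by apply/eqP; apply: contraT => /(act_free 0); rewrite a0 eqxx.
  by move=> ae; move: l0; rewrite ae lin0 ltxx.
rewrite -actN_gt0; apply/negP => /alphaP; rewrite linN; lra.
Qed.

Lemma lin_lt a b : (lin alpha a < lin alpha b) = (act a 0 < act b 0).
Proof.
rewrite -subr_gt0 -linN -linD lin_gt0 -[LHS](act_lt a) -actD.
by rewrite [a + _]addrC subrK.
Qed.

Lemma lin_neq0 a : a != 0 -> lin alpha a != 0.
Proof.
move=> a0; have := act_free 0 a0; rewrite neq_lt => /orP[].
  by rewrite -actN_gt0 -lin_gt0 linN oppr_gt0 => /lt_eqF ->.
by rewrite -lin_gt0 => /gt_eqF ->.
Qed.

Lemma lin_small (e : R) : 0 < e -> exists a, 0 < lin alpha a < e.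
Proof.
move=> e0; apply: contrapT => ne; have T0 := period_gt0 R.
pose S := [set x | exists a, 0 < lin alpha a /\ x = lin alpha a].
have eS x : S x -> e <= x.
  move=> [a [a0 ->]]; rewrite leNgt; apply/negP => ae; apply: ne; exists a.
  by rewrite a0 ae.
have S0 : S T by exists (0, 1); rewrite /lin /= mul0r add0r mul1r.
have hS : has_inf S by split; [exists T|exists e].
have eI : e <= inf S by apply: lb_le_inf => //; exists T.
have [|x [a [a0 xa]] xI] := @inf_adherent R S (inf S) _ hS; first by lra.
have /eqP an0 : a != 0 by apply/eqP => ae; rewrite ae lin0 ltxx in a0.
(* Otherwise the remainder [r] of [lin alpha b] modulo [x] would satisfy both
   [inf S <= r] and [inf S <= x - r], although [x < 2 * inf S]. *)
have mult b : exists k : int, b = a *~ k.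
  have x0 : 0 < x by rewrite xa.
  have /andP[] := floor_itv (lin alpha b / x).
  set k := Num.floor _; rewrite ler_pdivlMr // ltr_pdivrMr // intrD mulrDl mul1r => h1 h2.
  exists k; apply/eqP; rewrite -subr_eq0; apply: contraT => /lin_neq0.
  rewrite linD linN linMz -xa => n0.
  have p1 : 0 < lin alpha b - k%:~R * x by rewrite lt_neqAle eq_sym n0; lra.
  have l1 : inf S <= lin alpha b - k%:~R * x.
    apply: ge_inf; first exact: hS.2.
    by exists (b - a *~ k); rewrite linD linN linMz -xa.
  have l2 : inf S <= x - (lin alpha b - k%:~R * x).
    apply: ge_inf; first exact: hS.2.
    by exists (a - (b - a *~ k)); rewrite !linD !linN linD linN linMz -xa; split => //; lra.
  lra.
(* The integer pairs do not form a cyclic group. *)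
have [k hk] := mult (0, 1); have [l hl] := mult (1, 0).
move: hk hl; rewrite !pair_mulz => -[k1 k2] [l1 l2].
nia.
Qed.

Lemma lin_dense s t : s < t -> exists a, s < lin alpha a < t.
Proof.
rewrite -subr_gt0 => /lin_small[a /andP[a0 ast]].
have /andP[] := floor_itv (s / lin alpha a); rewrite ler_pdivlMr // ltr_pdivrMr //.
set k := Num.floor _ => h1 h2; exists (a *~ (k + 1)); rewrite linMz h2 /=.
by move: h1; rewrite intrD mulrDl mul1r; lra.
Qed.

Definition below t : set R := [set x | exists a, lin alpha a <= t /\ x = act a 0].

Lemma has_sup_below t : has_sup (below t).
Proof.
split.
  have [|a /andP[_ at_]] := @lin_dense (t - 1) t; first by lra.
  by exists (act a 0), a; split => //; exact: ltW.
have [|b /andP[tb _]] := @lin_dense t (t + 1); first by lra.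
exists (act b 0) => _ [a [at_ ->]]; apply: ltW; rewrite -lin_lt.
exact: le_lt_trans tb.
Qed.

(** [g t] is the supremum of the orbit points of 0 whose linear value is at most [t]. *)
Lemma inverse_semiconjugacy : exists g : R -> R,
  {homo g : s t / s < t} /\ forall a t, g (t + lin alpha a) = act a (g t).
Proof.
pose g t := sup (below t).
have gub a t : lin alpha a <= t -> act a 0 <= g t.
  by move=> h; apply: sup_upper_bound; [exact: has_sup_below|exists a].
have glb b t : t < lin alpha b -> g t <= act b 0.
  move=> tb; apply: ge_sup; first exact: (has_sup_below t).1.
  move=> _ [a [at_ ->]]; apply: ltW; rewrite -lin_lt; exact: le_lt_trans tb.
exists g; split.
  (* Strictness needs two intermediate values: [g s] is at most [act a 0], and [g t] at least
     [act b 0]. *)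
  move=> s t st; have [a /andP[sa at_]] := lin_dense st.
  have [b /andP[ab bt]] := lin_dense at_.
  apply: le_lt_trans (glb _ _ sa) _; rewrite lin_lt in ab.
  exact: lt_le_trans ab (gub _ _ (ltW bt)).
have le1 a t : g (t + lin alpha a) <= act a (g t).
  apply: ge_sup; first exact: (has_sup_below _).1.
  move=> _ [b [bt ->]]; rewrite -(subrK a b) addrC actD act_le; apply: gub.
  by rewrite linD linN; lra.
move=> a t; apply/eqP; rewrite eq_le le1 /=.
(* The reverse inequality is [le1] at [- a]. *)
rewrite -[X in _ <= X](actNK a) act_le; apply: le_trans (le1 _ _).
by rewrite linN addrK.
Qed.

End with_translation_number.

End rotation_order.

(** * Denjoy homeomorphisms are sensitive *)

Section denjoy_sensitive.
Variable R : realType.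
Local Notation T := (2 * pi : R).
Local Notation circle := (circle R).
Implicit Types (s t : R) (x y z : circle) (f : homeo circle) (H : homeo R).

(** The bound is the chord of an arc of length [e]; chords grow with the arc up to [pi] and are
    symmetric beyond. *)
Lemma mdist_cis_ge (e s t : R) : 0 < e -> e <= pi -> e <= t - s <= T - e ->
  Num.sqrt (2 - 2 * cos e) <= mdist (cis s) (cis t).
Proof.
move=> e0 ep /andP[h1 h2]; have p0 := @pi_gt0 R.
have cosle v : e <= v <= pi -> cos v <= cos e.
  move=> /andP[v1 v2]; have [->|ne] := eqVneq e v; first by rewrite lexx.
  apply: ltW; rewrite ltr_cos ?in_itv /= ?v2 ?ep ?(ltW e0) ?(le_trans (ltW e0) v1) //.
  by rewrite lt_neqAle ne.
suff ct : cos (s - t) <= cos e.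
  rewrite -[mdist _ _](ger0_norm (mdist_ge0 _ _)) -sqrtr_sqr; apply: ler_wsqrtr.
  by rewrite mdist_cis_sqr; lra.
rewrite -cosN opprB.
have [tp|tp] := leP (t - s) pi; first by apply: cosle; rewrite h1 tp.
have <- : cos (T - (t - s)) = cos (t - s).
  by rewrite -[RHS]cosN -(xc_cis (- _)) -cisDT xc_cis addrC.
by apply: cosle; apply/andP; split; lra.
Qed.

Lemma descend_homeo H : (forall t, H (t + T) = H t + T) ->
  exists K : homeo circle, forall t, K (cis t) = cis (H t).
Proof.
move=> HT.
have ITt t : homeo_inv H (t + T) = homeo_inv H t + T.
  by apply: (@homeo_inj _ H); rewrite HT !homeo_invK.
have desc (L : R -> R) : continuous L -> (forall t, L (t + T) = L t + T) ->
    continuous ((@cis R \o L) \o @arg R) /\ forall t, cis (L (arg (cis t))) = cis (L t).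
  move=> Lc LT; have per t : (@cis R \o L) (t + T) = (@cis R \o L) t.
    by rewrite /= LT cisDT.
  split.
    apply: descend_cont => // t.
    by apply: continuous_comp; [exact: Lc|exact: cis_cont].
  move=> t; have [m ->] := cis_eq (argK (cis t)); exact: (periodicz per).
have [Kc KE] := desc _ (homeo_cont (h := H)) HT.
have [Jc JE] := desc _ (homeo_inv_cont (h := H)) ITt.
have KJ : cancel ((@cis R \o H) \o @arg R) ((@cis R \o homeo_inv H) \o @arg R).
  by move=> z; rewrite /= JE homeo_funK argK.
have JK : cancel ((@cis R \o homeo_inv H) \o @arg R) ((@cis R \o H) \o @arg R).
  by move=> z; rewrite /= KE homeo_invK argK.
by exists (Homeo KJ JK Kc Jc) => t; exact: KE.
Qed.

Lemma lin1T (alpha : R) : lin alpha (0, 1) = T.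
Proof. by rewrite /lin mul0r add0r mul1r. Qed.

Lemma continuous_semiconj_rotation f H (alpha : R) (g : R -> R) : is_lift f H ->
  {homo g : s t / s < t} -> (forall a t, g (t + lin alpha a) = act H a (g t)) ->
  continuous g -> conjugate f (rotation (cis alpha)).
Proof.
move=> fH gi gE gc.
have gT t : g (t + T) = g t + T by have := gE (0, 1) t; rewrite lin1T /act /= mul1r.
have [G hG] := increasing_surj_homeo gi (equivariant_surj gc gT).
have [|K hK] := @descend_homeo G; first by move=> t; rewrite hG.
(* [K] carries the rotation to [f], so the conjugacy sought is its inverse. *)
exists (homeo_pow K (-1)) => z.
have e y : homeo_pow K (-1) (K y) = y.
  by rewrite -[LHS]/(homeo_iter K (-1) (homeo_iter K 1 y)) -homeo_iterD.
have [w ->] : exists w, z = K w by exists (homeo_inv K z); rewrite homeo_invK.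
rewrite e -[w]argK hK; have [_ _ _ ->] := fH; rewrite hG.
have -> : H (g (arg w)) = g (arg w + alpha).
  have := gE (1, 0) (arg w); rewrite /lin /act /= mul1r mul0r !addr0 => ->.
  by [].
by rewrite -hG -hK e rotation_cis addrC.
Qed.

Lemma jump_separates f H (alpha : R) (g : R -> R) : is_lift f H ->
  (forall s t, s < t -> exists a, s < lin alpha a < t) ->
  {homo g : s t / s < t} -> (forall a t, g (t + lin alpha a) = act H a (g t)) ->
  ~ continuous g ->
  exists2 delta : R, 0 < delta & forall s t, (forall m : int, s <> t + m%:~R * T) ->
    exists n : int, delta <= mdist (homeo_iter f n (cis (g s))) (homeo_iter f n (cis (g t))).
Proof.
move=> fH dense gi gE gnc; have T0 := period_gt0 R; have p0 := @pi_gt0 R.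
have gle : {mono g : s t / s <= t} by apply: le_mono.
have gT t : g (t + T) = g t + T by have := gE (0, 1) t; rewrite lin1T /act /= mul1r.
(* For monotone [g], an oscillation below [e] across [p] for every [e] is continuity at [p]. *)
have [p [e e0 jump]] : exists p, exists2 e : R, 0 < e &
    forall s t, s < p -> p < t -> e <= g t - g s.
  apply: contrapT => nj; apply: gnc => p; rewrite /continuous_at; apply/cvgrPdist_lt => e e0.
  apply: contrapT => ne; apply: nj; exists p, e => // s t sp pt.
  rewrite leNgt; apply/negP => lt; apply: ne; near=> u.
  have su : g s < g u by apply: gi; near: u; exact: lt_nbhsr.
  have ut : g u < g t by apply: gi; near: u; exact: lt_nbhsl.
  have := gi _ _ sp; have := gi _ _ pt.
  by rewrite ltr_norml => *; apply/andP; split; lra.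
(* Bounds the complementary arc from below; the cap at [pi] in [eps] is for [mdist_cis_ge]. *)
pose e' := g (p + 3 / 2 * pi) - g (p + pi).
have e'0 : 0 < e' by rewrite subr_gt0; apply: gi; lra.
pose eps := Num.min (Num.min e e') pi.
have eps0 : 0 < eps by rewrite !lt_min e0 e'0 p0.
have [epse epse' epspi] : [/\ eps <= e, eps <= e' & eps <= pi].
  by rewrite !ge_min !lexx !orbT.
pose delta := Num.sqrt (2 - 2 * cos eps).
have d0 : 0 < delta.
  rewrite sqrtr_gt0; have : cos eps < cos 0.
    by rewrite ltr_cos ?in_itv /= ?lexx ?(ltW p0) ?(ltW eps0) ?epspi.
  by rewrite cos0; lra.
have itE a t : homeo_iter f a.1 (cis (g t)) = cis (g (t + lin alpha a)).
  by rewrite gE (lift_iter fH) /act cisDz.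
have close s t : s < t -> t - s <= pi ->
    exists n : int, delta <= mdist (homeo_iter f n (cis (g s))) (homeo_iter f n (cis (g t))).
  move=> st tspi.
  (* Move [s] to just before [p]; then [t] lies after [p], but so little that
     the complementary arc still covers the image of [p + pi, p + 3/2 pi]. *)
  have [|a] := dense (p - Num.min (pi / 2) (t - s) - s) (p - s).
    by rewrite ltrD2r ltrBlDr ltrDl lt_min; apply/andP; split; lra.
  have : Num.min (pi / 2) (t - s) <= pi / 2 by rewrite ge_min lexx.
  have : Num.min (pi / 2) (t - s) <= t - s by rewrite ge_min lexx orbT.
  move: (Num.min _ _) => w w1 w2 /andP[a1 a2].
  exists a.1; rewrite !itE; apply: mdist_cis_ge => //.
  have h3 : e <= g (t + lin alpha a) - g (s + lin alpha a) by apply: jump; lra.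
  have h1 : g (t + lin alpha a) <= g (p + pi) by rewrite gle; lra.
  have h2 : g (p + 3 / 2 * pi) <= g (s + lin alpha a + T) by rewrite gle; lra.
  rewrite gT in h2.
  by rewrite /e' in epse'; apply/andP; split; lra.
have cT t (m : int) : cis (g (t + m%:~R * T)) = cis (g t).
  by apply: (@periodicz _ _ (fun t => cis (g t))) => u; rewrite gT cisDT.
exists delta => // s t nst.
have [m /andP[m0 m1]] := modT_exists (t - s).
rewrite -(cT s m).
have neq : t - s - m%:~R * T != 0.
  by apply/eqP => h; apply: (nst (- m)); rewrite intrN mulNr; lra.
have m0' : 0 < t - s - m%:~R * T by rewrite lt_neqAle eq_sym neq.
have [le|gt] := leP (t - s - m%:~R * T) pi; first by apply: close; lra.
(* Beyond half a turn, the short way leads from [t] to the next copy of [s]. *)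
have [||n hn] := close t (s + m%:~R * T + T); [lra|lra|].
by exists n; rewrite metric_sym; move: hn; rewrite gT cisDT.
Unshelve. all: by end_near. Qed.

(** * Measurability and the sensitive measure *)

Lemma continuous_borel_measurable (X : ptopologicalType) (h : X -> R) :
  continuous h -> measurable_fun [set: borel X] (h : borel X -> R).
Proof.
move=> /continuousP hc; apply: (measurability _ (RGenOpens.measurableE R)).
move=> _ [_ [x [y ->]] <-]; rewrite setTI; apply: sub_sigma_algebra.
by apply: hc; exact: interval_open.
Qed.

(** The sigma-algebra is the product of the Borel ones, so the squared distance is written as a
    polynomial in coordinates of the single points. *)
Lemma measurable_never_apart f (delta : R) : 0 <= delta ->
  measurable [set p : borel circle * borel circle | forall n : int,
    mdist (homeo_iter f n p.1) (homeo_iter f n p.2) < delta].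
Proof.
move=> d0.
pose d (n : int) (p : borel circle * borel circle) : R :=
  2 - 2 * (xc (homeo_iter f n p.1) * xc (homeo_iter f n p.2) +
           yc (homeo_iter f n p.1) * yc (homeo_iter f n p.2)).
have dE n p :
    (mdist (homeo_iter f n p.1 : circle) (homeo_iter f n p.2) < delta) = (d n p < delta ^+ 2).
  by rewrite /d -circle_mdist_sqr ltr_pXn2r // nnegrE ?mdist_ge0.
have mc (h : circle -> R) n : continuous h ->
    measurable_fun [set: borel circle] ((h \o homeo_iter f n) : borel circle -> R).
  move=> hc; apply: continuous_borel_measurable => x.
  by apply: continuous_comp; [exact: homeo_iter_cont|exact: hc].
have m1 (h : circle -> R) n : continuous h -> measurable_fun setT
    (fun p : borel circle * borel circle => h (homeo_iter f n p.1)).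
  by move=> hc; exact: (measurableT_comp (mc h n hc) measurable_fst).
have m2 (h : circle -> R) n : continuous h -> measurable_fun setT
    (fun p : borel circle * borel circle => h (homeo_iter f n p.2)).
  by move=> hc; exact: (measurableT_comp (mc h n hc) measurable_snd).
have md n : measurable_fun setT (d n).
  have cx := @xc_cont R; have cy := @yc_cont R.
  apply: measurable_funB => //; apply: measurable_funM => //.
  apply: measurable_funD; apply: measurable_funM;
    by [exact: m1|exact: m2].
have ml n : measurable [set p | d n p < delta ^+ 2].
  rewrite -[X in measurable X]setTI; exact: (@measurable_fun_ltr).
rewrite (_ : [set p | _] = (\bigcap_n [set p | d (Posz n) p < delta ^+ 2]) `&`
                           (\bigcap_n [set p | d (Negz n) p < delta ^+ 2])).
  by apply: measurableI; apply: bigcapT_measurable => n; exact: ml.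
apply/seteqP; split => p.
  by move=> h; split => n _ /=; rewrite -dE; exact: h.
by move=> [h1 h2] [n|n]; rewrite dE; [exact: h1|exact: h2].
Qed.

(** For the law of [k], the product measure integrates the measures of sections, and the section of
    the exceptional set at each [k s] is null. *)
Lemma sensitive_of_separation f (k : R -> circle) (P : probability (measurableTypeR R) R)
    (delta : R) : 0 < delta ->
  measurable_fun [set: measurableTypeR R] (k : measurableTypeR R -> borel circle) ->
  (forall s, P [set t | forall n : int,
    mdist (homeo_iter f n (k s)) (homeo_iter f n (k t)) < delta] = 0%E) ->
  exists mu : probability (borel circle) R, pairwise_sensitive f mu.
Proof.
move=> d0 mk null.
pose K : {mfun measurableTypeR R >-> borel circle} := mfun_Sub (mem_set mk).
pose mu : probability (borel circle) R := distribution P K.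
exists mu, delta => //.
pose A := [set p : borel circle * borel circle | forall n : int,
    mdist (homeo_iter f n p.1 : circle) (homeo_iter f n p.2) < delta].
have mA : measurable A by apply: measurable_never_apart; exact: ltW.
exists A; split => //; last first.
  by move=> p /= h n; rewrite ltNge; apply/negP => le; apply: h; exists n.
rewrite /product_measure1 ge0_integral_distribution //; last first.
  exact: measurable_fun_xsection.
rewrite integral0_eq // => s _ /=.
have -> : mu (xsection A (k s)) = P [set t | forall n : int,
    mdist (homeo_iter f n (k s)) (homeo_iter f n (k t)) < delta].
  rewrite /mu /distribution /pushforward /=; congr (P _).
  by apply/seteqP; split => t; rewrite /xsection /= inE.
exact: null.
Qed.

Lemma denjoy_sensitive f : denjoy f ->
  exists mu : probability (borel circle) R, pairwise_sensitive f mu.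
Proof.
move=> [_ noper nconj]; have T0 := period_gt0 R.
have [[L /lift_homeo[H fH]]|[[z fz] _]] := lift_dichotomy f; last first.
  by case: (noper z); exists 0%N.
have [alpha alphaP] := translation_number fH noper.
have [g [gi gE]] := inverse_semiconjugacy fH noper alphaP.
have gnc : ~ continuous g.
  move=> gc; apply: nconj; exists (cis alpha).
  exact: (continuous_semiconj_rotation fH gi gE gc).
have [delta d0 sep] := jump_separates fH (lin_dense fH noper alphaP) gi gE gnc.
have mk : measurable_fun [set: measurableTypeR R]
    ((fun t => cis (g t)) : measurableTypeR R -> borel circle).
  apply: (@measurability _ _ (measurableTypeR R) (borel circle) setT _ (@open circle) erefl).
  move=> _ [U oU <-]; rewrite setTI.
  (* [g] is discontinuous, but monotone functions are Borel. *)
  have mg : measurable_fun setT (g : measurableTypeR R -> measurableTypeR R).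
    apply: nondecreasing_measurable => // s t; rewrite le_eqVlt => /orP[/eqP->//|/gi/ltW//].
  rewrite -[X in measurable X]setTI; apply: (mg measurableT (@cis R @^-1` U)).
  apply: open_measurable; move/continuousP: (@cis_cont R); exact.
apply: (@sensitive_of_separation f _ (uniform_prob T0) delta d0 mk) => s.
(* Only translates of [s] by multiples of [T] escape separation; a countable set is null for the
   uniform law. *)
have cA : countable [set t | forall n : int, mdist (homeo_iter f n (cis (g s)))
    (homeo_iter f n (cis (g t))) < delta].
  apply: (@sub_countable _ _ _ ((fun m : int => s + m%:~R * T) @` setT)); last first.
    by apply: sub_countable (card_image_le _ _) _; exact: countableP.
  apply: subset_card_le => t ht; apply: contrapT => nt.
  have [|n] := sep t s; first by move=> m e; apply: nt; exists m.
  by rewrite leNgt metric_sym ht.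
have /null_content_dominatesP := dominates_uniform_prob T0; apply.
  by apply: countable_measurable => // t; exact: measurable_set1.
exact: countable_lebesgue_measure0.
Qed.

End denjoy_sensitive.

Theorem theorem2p10 (R : realType) (f : homeo (circle R)) :
  (exists mu : probability (borel (circle R)) R, pairwise_sensitive f mu) <->
  denjoy f.
Proof.
split=> [[mu]|]; [exact: sensitive_denjoy|exact: denjoy_sensitive].
Qed.
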